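(* Let $n\in\mathbb N$ and $S\subseteq[n-1]$. Then $$F_{n,S}(\mathbf x)=\sum_{\alpha}\frac{\Psi_\alpha(\mathbf x)}{z_\alpha}(-1)^{|S\setminus S_\alpha|},$$ where the sum ranges over all compositions $\alpha$ of $n$ such that $S$ is $\alpha$-unimodal.
   Context: A composition $\alpha=(\alpha_1,\dots,\alpha_\ell)$ of $n$ is a sequence of positive integers summing to $n$; $\ell(\alpha)=\ell$; $S_\alpha=\{\alpha_1,\alpha_1+\alpha_2,\dots,\alpha_1+\dots+\alpha_{\ell-1}\}$; blocks $B_i(\alpha)=\{\alpha_1+\dots+\alpha_{i-1}+1,\dots,\alpha_1+\dots+\alpha_i\}$. $\alpha\le\beta$ means $S_\beta\subseteq S_\alpha$. A set $S\subseteq[n-1]$ is $\alpha$-unimodal if for every $i$ the set $S\cap(B_i(\alpha)\setminus S_\alpha)$ is an initial segment (in increasing order) of $B_i(\alpha)\setminus S_\alpha$. Quasisymmetric functions in $\mathbf x=(x_1,x_2,\dots)$: monomial $M_\alpha=\sum_{i_1<\dots<i_\ell}x_{i_1}^{\alpha_1}\cdots x_{i_\ell}^{\alpha_\ell}$; fundamental $F_{n,S}=\sum x_{j_1}\cdots x_{j_n}$ over $j_1\le\dots\le j_n$ with $j_i<j_{i+1}$ for $i\in S$. $z_\alpha=\prod_{i\ge1}i^{m_i}m_i!$ with $m_i$ the number of parts equal to $i$. For a composition $\gamma$ set $\pi(\gamma)=\prod_{i=1}^{\ell(\gamma)}(\gamma_1+\dots+\gamma_i)$; for $\alpha\le\beta$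 set $\pi(\alpha,\beta)=\prod_{i=1}^{\ell(\beta)}\pi(\alpha^{(i)})$, where $\alpha^{(i)}$ is the composition of $\beta_i$ formed by the parts $\alpha_j$ with $B_j(\alpha)\subseteq B_i(\beta)$. The quasisymmetric power sum is $\Psi_\alpha=z_\alpha\sum_{\beta\ge\alpha}\frac{1}{\pi(\alpha,\beta)}M_\beta$. *)

(* Defs.v *)
(* Quasisymmetric functions in x = (x_1, x_2, ...) are
   represented by their coefficient maps: a monomial x_1^{e_0} x_2^{e_1} ...
   is encoded by a finite exponent list e : seq nat (trailing zeros harmless);
   two series are equal iff all their coefficients agree. *)
From mathcomp Require Import all_boot all_order all_algebra.
Set Implicit Arguments. Unset Strict Implicit. Unset Printing Implicit Defensive.
Import GRing.Theory Num.Theory.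

Definition is_comp (n : nat) (a : seq nat) : bool :=
  all (fun x => 0 < x) a && (sumn a == n).

Fixpoint seqs_upto (k m : nat) : seq (seq nat) :=
  match k with
  | 0 => [:: [::]]
  | k'.+1 => [::] :: [seq x :: s | x <- iota 0 m.+1, s <- seqs_upto k' m]
  end.

Definition compositions (n : nat) : seq (seq nat) :=
  [seq a <- seqs_upto n n | is_comp n a].

Definition Sset (a : seq nat) : seq nat :=
  [seq sumn (take k a) | k <- iota 1 (size a).-1].

Definition comp_le (a b : seq nat) : bool :=
  all (fun s => s \in Sset a) (Sset b).

Definition block (a : seq nat) (i : nat) : seq nat :=
  iota (sumn (take i a)).+1 (nth 0 a i).

(* S is alpha-unimodal: S meets each B_i(alpha)\S_alpha in an initial segment *)
Definition unimodal (a : seq nat) (S : seq nat) : bool :=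
  all (fun i =>
         let L := [seq k <- block a i | k \notin Sset a] in
         [seq k <- L | k \in S] == take (count (mem S) L) L)
      (iota 0 (size a)).

Definition zee (a : seq nat) : nat :=
  \prod_(1 <= i < (sumn a).+1) (i ^ count_mem i a * (count_mem i a)`!).

Definition piC (g : seq nat) : nat := \prod_(i < size g) sumn (take i.+1 g).

Definition subcomp (a b : seq nat) (i : nat) : seq nat :=
  [seq nth 0 a j | j <- iota 0 (size a) &
                   all (fun k => k \in block b i) (block a j)].

Definition pi2 (a b : seq nat) : nat := \prod_(i < size b) piC (subcomp a b i).

(* coefficient of x^e in M_b: number of i_1 < ... < i_l with
   x_{i_1}^{b_1} ... x_{i_l}^{b_l} = x^e  (variables indexed from 0 here) *)
Definition Mcoef (b : seq nat) (e : seq nat) : nat :=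
  #|[pred t : (size b).-tuple 'I_(size e) |
      sorted ltn (map val t) &&
      all (fun k => nth 0 e k ==
                    \sum_(u < size b) ((val (tnth t u) == k) * nth 0 b u))
          (iota 0 (size e))]|.

(* coefficient of x^e in F_{n,S}: number of j_1 <= ... <= j_n with
   j_i < j_{i+1} for i in S and x_{j_1}...x_{j_n} = x^e *)
Definition Fcoef (n : nat) (S : seq nat) (e : seq nat) : nat :=
  #|[pred j : n.-tuple 'I_(size e) |
      let s := map val j in
      all (fun i => if i.+1 \in S then nth 0 s i < nth 0 s i.+1
                    else nth 0 s i <= nth 0 s i.+1) (iota 0 n.-1) &&
      all (fun k => nth 0 e k == count_mem k s) (iota 0 (size e))]|.

Definition Psicoef (a : seq nat) (e : seq nat) : rat :=
  ((zee a)%:R * \sum_(b <- compositions (sumn a) | comp_le a b)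
                  ((pi2 a b)%:R)^-1 * (Mcoef b e)%:R)%R.

(* Main.v *)
Require Import Defs.
From mathcomp Require Import all_boot all_order all_algebra.
From mathcomp Require Import zify ring.
Set Implicit Arguments. Unset Strict Implicit. Unset Printing Implicit Defensive.
Import GRing.Theory Num.Theory.

(* The coefficient of x^e in M_b is 1 if b is the list B of nonzero entries of
   e and 0 otherwise; the coefficient in F_{n,S} is 1 if B is a composition of n
   with S contained in Sset B, and 0 otherwise.  The theorem thus reduces to
     sum over a <= B with S a-unimodal of (-1)^|S \ Sset a| / pi2 a B
       = [S is contained in Sset B].
   Encode a by T = Sset a.  Then pi2 a B is the product over t in T and t = n of
   the distance from t to the preceding element of {0} u Sset B, and
   unimodality only involves consecutive integers k-1, k, so each summand is a
   product of local weights at k = 1, ..., n-1.  Scan k from left to right: let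
   X and Y be the partial sums over the T with k in T and k not in T.  As long
   as S stays inside Sset B, X = 1 and Y is the distance from k to the last
   break of B; after the first element of S outside Sset B, X + Y = 0 for ever. *)

(** * Partial sums and break sets *)

(** Unlike [Sset], this keeps the total as its last entry, so that adding a part in front merely
    shifts the list and [a] can be recovered from it. *)
Definition psums (a : seq nat) : seq nat :=
  [seq sumn (take k a) | k <- iota 1 (size a)].

Lemma psums_cons x a : psums (x :: a) = x :: map (addn x) (psums a).
Proof.
rewrite /psums /= take0 addn0; congr cons.
by rewrite (iotaDl 1 1) -!map_comp; apply: eq_map => k /=.
Qed.

Lemma psums_cat a1 a2 :
  psums (a1 ++ a2) = psums a1 ++ map (addn (sumn a1)) (psums a2).
Proof.
elim: a1 => [|x a1 IH]; first by rewrite map_id.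
rewrite cat_cons !psums_cons IH map_cat -map_comp cat_cons.
by congr (_ :: (_ ++ _)); apply: eq_map => k /=; rewrite addnA.
Qed.

Lemma Sset_rcons a x : Sset (rcons a x) = psums a.
Proof.
rewrite /Sset size_rcons /= /psums; apply/eq_in_map => k.
rewrite mem_iota add1n ltnS => /andP[_ hk]; congr sumn.
by rewrite -cats1 takel_cat.
Qed.

Lemma psums_rcons a x : psums (rcons a x) = rcons (psums a) (sumn a + x).
Proof. by rewrite -cats1 psums_cat psums_cons /= cats1. Qed.

Lemma psumsE a : a != [::] -> psums a = rcons (Sset a) (sumn a).
Proof.
by case/lastP: a => // a x _; rewrite psums_rcons Sset_rcons sumn_rcons.
Qed.

Lemma psums_gt0 a k : all (fun x => 0 < x) a -> k \in psums a -> 0 < k.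
Proof.
elim: a k => [|x a IH] k //= /andP[x0 pa].
rewrite psums_cons inE => /orP[/eqP->//|/mapP[j _ ->]]; lia.
Qed.

Lemma leq_psums a k : k \in psums a -> k <= sumn a.
Proof.
elim: a k => [|x a IH] k //=.
rewrite psums_cons inE => /orP[/eqP->|/mapP[j /IH hj ->]]; lia.
Qed.

Lemma mem_Sset a k :
  all (fun x => 0 < x) a -> (k \in Sset a) = (k \in psums a) && (k < sumn a).
Proof.
case/lastP: a => // a x; rewrite all_rcons => /andP[x0 pa].
rewrite Sset_rcons psums_rcons mem_rcons inE sumn_rcons.
have [|_] := boolP (k \in psums a); last by rewrite orbF; case: eqP => // ->; rewrite ltnn.
by move/leq_psums => hk; rewrite orbT /=; lia.
Qed.

(** * Enumeration of compositions *)

Lemma seqs_uptoS k m : seqs_upto k.+1 m =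
  [::] :: [seq x :: s | x <- iota 0 m.+1, s <- seqs_upto k m].
Proof. by []. Qed.

Lemma mem_seqs_upto k m s :
  (s \in seqs_upto k m) = (size s <= k) && all (fun x => x <= m) s.
Proof.
elim: k s => [|k IH] [|x s] //.
rewrite seqs_uptoS inE [_ == _]/=; apply/allpairsP/idP => [[[y t] [hy ht [-> ->]]]|].
  by move: hy ht; rewrite (mem_iota 0 m.+1) IH /=; lia.
move=> /and3P[hs hx ha]; exists (x, s) => /=; split => //.
  by rewrite (mem_iota 0 m.+1); lia.
by rewrite IH; apply/andP; split.
Qed.

Lemma uniq_seqs_upto k m : uniq (seqs_upto k m).
Proof.
elim: k => [|k IH] //; rewrite seqs_uptoS cons_uniq.
apply/andP; split; first by apply/allpairsP => -[[y t] /= []].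
apply: (allpairs_uniq (f := cons)) => //; first exact: (iota_uniq 0 m.+1).
by move=> [x s] [y t] _ _ /= [-> ->].
Qed.

Lemma leq_size_sumn (a : seq nat) : all (fun x => 0 < x) a -> size a <= sumn a.
Proof. by elim: a => //= x a IH /andP[x0 /IH]; lia. Qed.

Lemma leq_sumn (a : seq nat) x : x \in a -> x <= sumn a.
Proof. by elim: a => //= y a IH; rewrite inE => /orP[/eqP->|/IH]; lia. Qed.

(** Positivity of the parts bounds both the length and every entry by [n], so the finite enumeration
    misses no composition. *)
Lemma mem_compositions n a : (a \in compositions n) = is_comp n a.
Proof.
rewrite mem_filter andb_idr // => /andP[pa /eqP <-]; rewrite mem_seqs_upto.
by rewrite leq_size_sumn //; apply/allP => x; apply: leq_sumn.
Qed.

Lemma uniq_compositions n : uniq (compositions n).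
Proof. exact/filter_uniq/uniq_seqs_upto. Qed.

(** * Compositions of m+1 as subsets of {1, ..., m} *)

(** Subsets of {1, ..., m} as increasing lists. The largest element is decided last, which matches
    the scan from left to right. *)
Fixpoint subset_seqs (m : nat) : seq (seq nat) :=
  if m is m'.+1 then subset_seqs m' ++ [seq rcons T m | T <- subset_seqs m'] else [:: [::]].

Lemma subset_seqs_bound m T k : T \in subset_seqs m -> k \in T -> 0 < k <= m.
Proof.
elim: m T => [|m IH] T /=; first by rewrite inE => /eqP->.
rewrite mem_cat => /orP[hT hk|/mapP[T' hT' ->]].
  by have := IH _ hT hk; lia.
by rewrite mem_rcons inE => /orP[/eqP->|/(IH _ hT')]; lia.
Qed.

Lemma uniq_subset_seqs m : uniq (subset_seqs m).
Proof.
elim: m => //= m IH; rewrite cat_uniq IH /= map_inj_in_uniq ?IH ?andbT.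
  apply/hasP => -[T /mapP[T' _ ->]] /subset_seqs_bound h.
  by have := h m.+1; rewrite mem_rcons inE eqxx => /(_ isT); lia.
by move=> T T' _ _ /rcons_inj [].
Qed.

Lemma psums_inj : injective psums.
Proof.
elim=> [|x a IH] [|y b] //; rewrite !psums_cons => -[<-].
by move/(inj_map (@addnI x))/IH->.
Qed.

(** Induction on [m] through the last part. If it is at least 2, lowering it by one keeps the break
    set; if it is 1, deleting it turns the largest break into the new total. *)
Lemma mem_map_Sset_compositions m T :
  (T \in [seq Sset a | a <- compositions m.+1]) = (T \in subset_seqs m).
Proof.
elim: m T => [|m IH] T.
  rewrite [RHS]mem_seq1; apply/mapP/eqP => [[a]|->]; last by exists [:: 1].
  rewrite mem_compositions => /andP[pa /eqP]; case/lastP: a pa => // a x.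
  rewrite all_rcons sumn_rcons Sset_rcons => /andP[x0 pa] sa.
  by have -> : a = [::] by case: a pa sa => //= *; lia.
rewrite [subset_seqs _]/= mem_cat -IH; apply/mapP/orP => [[a]|].
  rewrite mem_compositions => /andP[pa /eqP]; case/lastP: a pa => // a x.
  rewrite all_rcons sumn_rcons Sset_rcons => /andP[x0 pa] sa ->.
  have [x1|x1] := leqP 2 x; [left|right].
    apply/mapP; exists (rcons a x.-1); last by rewrite Sset_rcons.
    rewrite mem_compositions /is_comp all_rcons sumn_rcons pa; lia.
  have a0 : a != [::] by case: a sa {pa} => //=; lia.
  have sa1 : sumn a = m.+1 by lia.
  apply/mapP; exists (Sset a); last by rewrite psumsE ?sa1.
  by rewrite -IH map_f // mem_compositions /is_comp pa sa1 /=.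
case=> [/mapP[a]|/mapP[T']].
  rewrite mem_compositions => /andP[pa /eqP]; case/lastP: a pa => // a x.
  rewrite all_rcons sumn_rcons Sset_rcons => /andP[x0 pa] sa ->.
  exists (rcons a x.+1); rewrite ?Sset_rcons // mem_compositions.
  by rewrite /is_comp all_rcons sumn_rcons pa; lia.
rewrite -IH => /mapP[a]; rewrite mem_compositions => /andP[pa /eqP sa] -> ->.
exists (rcons a 1); rewrite ?Sset_rcons.
  by rewrite mem_compositions /is_comp all_rcons sumn_rcons pa sa addn1 eqxx.
by rewrite psumsE ?sa //; case: a sa {pa}.
Qed.

(** Injectivity holds because the common total supplies the one partial sum that [Sset] forgets. *)
Lemma perm_Sset_compositions m :
  perm_eq [seq Sset a | a <- compositions m.+1] (subset_seqs m).
Proof.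
apply: uniq_perm; [|exact: uniq_subset_seqs|by move=> T; rewrite mem_map_Sset_compositions].
rewrite map_inj_in_uniq ?uniq_compositions // => a b.
rewrite !mem_compositions => /andP[_ /eqP sa] /andP[_ /eqP sb] eS.
apply: psums_inj; rewrite !psumsE ?eS ?sa ?sb //.
  by case: b sb {eS}.
by case: a sa {eS}.
Qed.

(** * Local weights and the scan *)

(* [B] is the break set Sset of the coarser composition; [p] and [q] say whether
   k-1 and k lie in 0 :: T.  Weight 0 rules out the T that miss a break of B or for which S is
   not unimodal. *)
Definition local_weight (S B : pred nat) (d : nat -> nat) (k : nat) (p q : bool) : rat :=
  (if q then (d k)%:R^-1
   else if B k then 0
   else if S k then (if p || S k.-1 then -1 else 0)
   else 1)%R.

(** Position 0 counts as a cut. The factor of the endpoint [m.+1] is left out: it is the same for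
    all [T] and is divided out separately. *)
Definition weight (S B : pred nat) (d : nat -> nat) (m : nat) (T : seq nat) : rat :=
  (\prod_(1 <= k < m.+1) local_weight S B d k (k.-1 \in 0 :: T) (k \in T))%R.

Lemma weight_skip S B d m T : T \in subset_seqs m ->
  (weight S B d m.+1 T
  = weight S B d m T * local_weight S B d m.+1 (m \in 0 :: T) false)%R.
Proof.
move=> hT; rewrite /weight big_nat_recr // [m.+1.-1]/=;
  congr (_ * local_weight _ _ _ _ _ _)%R.
by apply/negP => /(subset_seqs_bound hT); lia.
Qed.

Lemma weight_take S B d m T : T \in subset_seqs m ->
  (weight S B d m.+1 (rcons T m.+1)
  = weight S B d m T * local_weight S B d m.+1 (m \in 0 :: T) true)%R.
Proof.
move=> hT; rewrite /weight big_nat_recr // [m.+1.-1]/=;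
  congr (_ * local_weight _ _ _ _ _ _)%R.
- rewrite !big_nat; apply: eq_bigr => k hk; rewrite !inE !mem_rcons !inE.
  have -> : (k == m.+1) = false by lia.
  by have -> : (k.-1 == m.+1) = false by lia.
- rewrite !inE mem_rcons inE; by have -> : (m == m.+1) = false by lia.
- by rewrite mem_rcons inE eqxx.
Qed.

(** The partial sum X of the scan; [weight_uncut] is Y. At [m = 0] the empty set counts as cut, so
    the scan starts from X = 1 and Y = 0. *)
Definition weight_cut S B d m : rat :=
  (\sum_(T <- subset_seqs m | m \in 0 :: T) weight S B d m T)%R.
Definition weight_uncut S B d m : rat :=
  (\sum_(T <- subset_seqs m | m \notin 0 :: T) weight S B d m T)%R.

Lemma sum_weight_split S B d m :
  (\sum_(T <- subset_seqs m) weight S B d m T = weight_cut S B d m + weight_uncut S B d m)%R.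
Proof. by rewrite (bigID (fun T => m \in 0 :: T)). Qed.

(** The weight of a cut ignores the state of the preceding position, so X and Y enter alike. *)
Lemma weight_cut_rec S B d m :
  (weight_cut S B d m.+1 = (weight_cut S B d m + weight_uncut S B d m) / (d m.+1)%:R)%R.
Proof.
rewrite -sum_weight_split /weight_cut /= big_cat big_map /= mulr_suml.
rewrite big_seq_cond big_pred0 ?add0r; last first.
  move=> T; apply/negP => /andP[/subset_seqs_bound h]; rewrite inE /= => /h; lia.
rewrite big_seq_cond [RHS]big_seq_cond; apply: eq_big => [T|T /andP[hT _]].
  by rewrite inE mem_rcons inE eqxx.
by rewrite weight_take.
Qed.

Lemma weight_uncut_rec S B d m :
  (weight_uncut S B d m.+1 = weight_cut S B d m * local_weight S B d m.+1 true false
    + weight_uncut S B d m * local_weight S B d m.+1 false false)%R.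
Proof.
rewrite /weight_uncut /= big_cat big_map /= [X in (_ + X)%R]big_pred0 ?addr0; last first.
  by move=> T; rewrite inE mem_rcons inE eqxx.
transitivity (\sum_(T <- subset_seqs m)
  weight S B d m T * local_weight S B d m.+1 (m \in 0 :: T) false)%R.
  rewrite big_seq_cond [RHS]big_seq; apply: eq_big => [T|T /andP[hT _]].
    rewrite andb_idr // => hT; rewrite inE /=.
    by apply/negP => /(subset_seqs_bound hT); lia.
  by rewrite weight_skip.
rewrite (bigID (fun T => m \in 0 :: T)) /= !mulr_suml.
by congr (_ + _)%R; apply: eq_bigr => T; [move=> -> | move=> /negbTE ->].
Qed.

(** In the failing case X + Y = 0 alone is not inductive: at an uncut element of S, the weight of
    the sets counted by Y depends on whether [S m] holds. The disjunction records what the next step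
    requires. *)
Lemma weight_scan (S B : pred nat) (d : nat -> nat) (n m : nat) :
  S 0 = false -> B 0 = false -> d 0 = 0 ->
  (forall k, k < n -> d k.+1 = if B k then 1 else (d k).+1) -> m < n ->
  if all (fun k => S k ==> B k) (iota 1 m)
  then weight_cut S B d m = 1%R /\ weight_uncut S B d m = (if B m then 0 else d m)%:R%R
  else (weight_cut S B d m + weight_uncut S B d m = 0)%R
       /\ (S m \/ weight_uncut S B d m = 0%R).
Proof.
move=> S0 B0 d0 dS; elim: m => [|m IH] hm.
  rewrite /= B0 d0 /weight_cut /weight_uncut /= !big_cons !big_nil inE eqxx /=.
  by rewrite /weight big_geq.
have {IH} := IH (ltnW hm).
have dm : (d m.+1 = (if B m then 0 else d m).+1) by rewrite dS ?(ltnW hm)//; case: (B m).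
have -> : iota 1 m.+1 = rcons (iota 1 m) m.+1 by rewrite -{1}(addn1 m) iotaD cats1 add1n.
rewrite all_rcons andbC weight_cut_rec weight_uncut_rec.
have [hg [-> eY]|_ [h0 hY]] /= := boolP (all _ _).
  (* A cut at [m.+1] therefore contributes [d m.+1] divided by itself, and X stays 1. *)
  have -> : (1 + weight_uncut S B d m = (d m.+1)%:R)%R.
    by rewrite eY dm -[RHS]natr1 addrC.
  rewrite divff ?pnatr_eq0 ?dm // -dm /local_weight /=.
  case hB: (B m.+1); first by rewrite implybT !mulr0 addr0.
  case hS: (S m.+1) => /=; last by rewrite !mulr1 eY dm -natr1 addrC.
  split; last by left.
  (* First element of S outside B: the cut sets contribute -1, which cancels the new X = 1. If [S m]
     holds too, then [B m] holds, so the old Y is 0 and adds nothing. *)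
  case hSm: (S m); last by rewrite mulr0; ring.
  suff -> : weight_uncut S B d m = 0%R by ring.
  rewrite eY; case: m hm dm hg hSm {eY hB hS} => [|m] hm dm hg hSm; first by rewrite S0 in hSm.
  move/allP/(_ m.+1): hg; rewrite mem_iota hSm /= => -> //; lia.
rewrite h0 mul0r /local_weight /= add0r.
case: (B _); first by rewrite !mulr0 addr0; split; [|right].
case: (S m.+1) => /=; last by rewrite !mulr1; split; [|right].
split; last by left.
(* If [S m] holds, both weights are -1 and multiply X + Y = 0; otherwise Y = 0 forces X = 0. *)
case: hY => [->|Y0]; first by rewrite -mulrDl h0 mul0r.
by move: h0; rewrite Y0 addr0 => ->; rewrite !mul0r addr0.
Qed.

(** The endpoint acts as one more cut: X + Y is [d m.+1] when S stays inside B, and 0 otherwise. *)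
Lemma sum_weight (S B : pred nat) (d : nat -> nat) (m : nat) :
  S 0 = false -> B 0 = false -> d 0 = 0 ->
  (forall k, k < m.+1 -> d k.+1 = if B k then 1 else (d k).+1) ->
  (\sum_(T <- subset_seqs m) weight S B d m T / (d m.+1)%:R
    = (all (fun k => S k ==> B k) (iota 1 m))%:R)%R.
Proof.
move=> S0 B0 d0 dS; have := weight_scan S0 B0 d0 dS (ltnSn m).
rewrite -mulr_suml sum_weight_split dS //.
case: ifP => [_ [-> ->]|_ [-> _]]; last by rewrite mul0r.
by case: (B m); rewrite ?addr0 ?divff // nat1r divff // pnatr_eq0.
Qed.

(** * Blocks and the local form of unimodality *)

Lemma sumn_take_S (a : seq nat) i :
  i < size a -> sumn (take i.+1 a) = sumn (take i a) + nth 0 a i.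
Proof. by move=> hi; rewrite (take_nth 0) // sumn_rcons. Qed.

Lemma leq_sumn_take (a : seq nat) k l :
  k <= l -> sumn (take k a) <= sumn (take l a).
Proof.
by move=> hkl; rewrite -(cat_take_drop k (take l a)) take_takel // sumn_cat leq_addr.
Qed.

Lemma mem_block a i k :
  (k \in block a i) = (sumn (take i a) < k <= sumn (take i a) + nth 0 a i).
Proof. by rewrite mem_iota; lia. Qed.

Lemma find_block a k :
  0 < k <= sumn a -> exists2 i, i < size a & k \in block a i.
Proof.
elim: a k => [|x a IH] k /=; first by lia.
have [hx|hx] := leqP k x => hk; first by exists 0; rewrite // mem_block /=; lia.
have [|i hi] := IH (k - x); first by lia.
rewrite mem_block => hb; exists i.+1; rewrite // mem_block /=; lia.
Qed.

Lemma Sset_interior a i y :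
  i < size a -> y \in block a i -> y.+1 \in block a i -> y \notin Sset a.
Proof.
rewrite !mem_block => hi h1 h2; apply/mapP => -[k _ hk].
have [hki|hki] := leqP k i; first by have := leq_sumn_take a hki; lia.
by have := leq_sumn_take a hki; rewrite sumn_take_S //; lia.
Qed.

(** Initial segments are the parts of [L] closed downwards; this replaces an equality of lists by a
    pointwise condition. *)
Lemma initialP (P : pred nat) L : sorted ltn L ->
  reflect (forall x y, x \in L -> y \in L -> x < y -> P y -> P x)
          (filter P L == take (count P L) L).
Proof.
elim: L => [|x L IH]; first by left.
rewrite [sorted _ _]/= => hp; have hmin := order_path_min ltn_trans hp.
have {}IH := IH (path_sorted hp).
case hx: (P x) => /=; rewrite hx /=.
  rewrite eqseq_cons eqxx /=; apply: (iffP IH) => h u v.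
    rewrite !inE => /orP[/eqP->//|hu] /orP[/eqP->|hv] huv; last exact: h.
    by move/allP/(_ _ hu): hmin; lia.
  by move=> hu hv; apply: h; rewrite inE ?hu ?hv orbT.
(* The head fails [P], so either side holds exactly when no later element satisfies [P]. *)
rewrite add0n; case hc: (count P L) => [|c].
  have hn : ~~ has P L by rewrite has_count hc.
  rewrite take0 -size_eq0 size_filter hc eqxx; left => u v hu.
  rewrite inE => /orP[/eqP->|hv]; first by rewrite hx.
  by move=> _ hPv; case/hasP: hn; exists v.
apply: (iffP eqP) => [h|h].
  by have : x \in filter P L; [rewrite h inE eqxx|rewrite mem_filter hx].
have /hasP[y hy hPy] : has P L by rewrite has_count hc.
move: (h x y); rewrite !inE eqxx hy orbT hx => hxy.
by have := hxy isT isT (allP hmin _ hy) hPy.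
Qed.

(** Only the last element of a block can be a break, so the other elements are consecutive integers
    and downward closure reduces to steps from [k] to [k.-1]. The condition on [k.-1] says that [k]
    does not open its block. *)
Lemma unimodalP a (S : seq nat) :
  all (fun i => 0 < i < sumn a) S ->
  reflect (forall k, k \in S -> k \notin Sset a -> k.-1 \notin 0 :: Sset a -> k.-1 \in S)
          (unimodal a S).
Proof.
move=> hS; have sL i : sorted ltn [seq k <- block a i | k \notin Sset a].
  exact/sorted_filter/iota_ltn_sorted/ltn_trans.
apply: (iffP allP) => [h k kS kT|h i].
  rewrite inE negb_or => /andP[k0 k1T]; have hk := allP hS _ kS.
  have [|i hi hb] := @find_block a k; first by lia.
  have hi0 : i \in iota 0 (size a) by rewrite mem_iota.
  apply: (elimT (initialP _ (sL i)) (h i hi0) k.-1 k); [| |lia|exact: kS].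
  - rewrite mem_filter k1T; move: hb k1T; rewrite !mem_block => hb k1T.
    (* Otherwise [k] opens block [i], and [k.-1] is 0 or a break, against the hypotheses. *)
    case: (ltnP (sumn (take i a)) k.-1) => [|hle] /=; first by lia.
    case/negP: k1T; apply/mapP; exists i; last by lia.
    rewrite mem_iota; case: i {hi0} hi hb hle => [|i] hi hb hle; last by lia.
    by rewrite take0 /= in hb hle; lia.
  - by rewrite mem_filter kT.
rewrite mem_iota => /= hi; apply/(initialP _ (sL i)) => x y.
rewrite !mem_filter => /andP[xT xb] /andP[yT yb] xy.
(* Membership in S is carried from [y] down to [x] one integer at a time. *)
elim: y yT yb xy => // y IH yT yb; rewrite ltnS leq_eqVlt => xy yS.
have y_b : y \in block a i by move: xb yb; rewrite !mem_block; lia.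
have yT' := Sset_interior hi y_b yb.
have {}yS : y \in S.
  apply: (h y.+1) => //=; rewrite inE negb_or yT' andbT.
  by move: xb xy; rewrite mem_block; lia.
by case/orP: xy => [/eqP->//|xy]; apply: IH.
Qed.

(** * Distances to the preceding break and the product formula for [pi2] *)

Lemma mem_psums_cons x a k :
  (k \in psums (x :: a)) = (k == x) || (x <= k) && (k - x \in psums a).
Proof.
rewrite psums_cons inE; congr (_ || _); apply/mapP/andP => [[j hj ->]|[h1 h2]].
  by rewrite addKn leq_addr.
by exists (k - x) => //; rewrite subnKC.
Qed.

Lemma uniq_psums a : all (fun x => 0 < x) a -> uniq (psums a).
Proof.
elim: a => // x a IH /andP[x0 pa]; rewrite psums_cons cons_uniq.
rewrite (map_inj_uniq (@addnI x)) IH // andbT; apply/mapP => -[j].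
by move/(psums_gt0 pa); lia.
Qed.

(* [dist b t] is the distance from [t] to the largest element below it
   of [0 :: Sset b]. *)
Fixpoint dist (b : seq nat) (t : nat) : nat :=
  if b is x :: b' then (if t <= x then t else dist b' (t - x)) else t.

Lemma dist0 b : dist b 0 = 0.
Proof. by case: b. Qed.

(** This is the recursion that the scan requires of its distance function. *)
Lemma distS b k : all (fun x => 0 < x) b -> k < sumn b ->
  dist b k.+1 = if k \in psums b then 1 else (dist b k).+1.
Proof.
elim: b k => // x b IH k /andP[x0 pb] hk; rewrite mem_psums_cons.
move: hk; rewrite /= => hk.
case: (ltngtP k x) => [//|hxk|->] /=.
  by rewrite subSn ?(ltnW hxk) //= IH //; lia.
rewrite subSnn; case: b IH pb hk => [//|y b] IH pb hk.
rewrite IH //; last by move: pb => /=; lia.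
by rewrite dist0; case: ifP.
Qed.

Lemma piCE g : piC g = \prod_(t <- psums g) t.
Proof.
rewrite /piC -(big_mkord xpredT (fun i => sumn (take i.+1 g))).
by rewrite /psums big_map (iotaDl 1 0) big_map /index_iota subn0.
Qed.

Lemma block_consS x b i : block (x :: b) i.+1 = map (addn x) (block b i).
Proof. by rewrite /block /= -addnS iotaDl. Qed.

Lemma block_cat_l a1 a2 j : j < size a1 -> block (a1 ++ a2) j = block a1 j.
Proof. by move=> hj; rewrite /block nth_cat hj takel_cat // ltnW. Qed.

Lemma block_cat_r a1 a2 j :
  block (a1 ++ a2) (size a1 + j) = map (addn (sumn a1)) (block a2 j).
Proof.
rewrite /block nth_cat ltnNge leq_addr /= addKn take_cat ltnNge leq_addr /= addKn.
by rewrite sumn_cat -addnS iotaDl.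
Qed.

Lemma block_last a i : all (fun x => 0 < x) a -> i < size a ->
  sumn (take i a) + nth 0 a i \in block a i.
Proof. by move=> /all_nthP h /h => /(_ 0); rewrite mem_block; lia. Qed.

Lemma block_first a i : all (fun x => 0 < x) a -> i < size a ->
  (sumn (take i a)).+1 \in block a i.
Proof. by move=> /all_nthP h /h => /(_ 0); rewrite mem_block; lia. Qed.

Lemma block_le a i k : i < size a -> k \in block a i -> 0 < k <= sumn a.
Proof.
move=> hi; rewrite mem_block -sumn_take_S // => hk.
by have := leq_sumn_take a hi; rewrite take_size; lia.
Qed.

(** Every block of [a1] lies in the first [x] integers, while the first element of each later block
    already exceeds [x]. *)
Lemma subcomp_cat0 a1 a2 x b :
  all (fun x => 0 < x) a2 -> sumn a1 = x ->
  subcomp (a1 ++ a2) (x :: b) 0 = a1.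
Proof.
move=> p2 s1; rewrite /subcomp size_cat iotaD filter_cat map_cat.
have -> : [seq j <- iota (0 + size a1) (size a2) |
  all (fun k => k \in block (x :: b) 0) (block (a1 ++ a2) j)] = [::].
  rewrite add0n -[size a1]addn0 iotaDl filter_map; apply/eqP.
  rewrite -size_eq0 size_map size_filter -leqn0 leqNgt -has_count.
  apply/hasP => -[j]; rewrite mem_iota => hj /allP hall.
  have := hall (sumn a1 + (sumn (take j a2)).+1).
  rewrite block_cat_r map_f ?block_first // => /(_ isT).
  by rewrite mem_block take0 s1 /=; lia.
rewrite cats0 (_ : filter _ _ = iota 0 (size a1)); last first.
  apply/all_filterP/allP => j; rewrite mem_iota => /= hj.
  rewrite block_cat_l //; apply/allP => k /(block_le hj).
  by rewrite mem_block /= s1; lia.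
rewrite -[RHS](mkseq_nth 0) /mkseq; apply/eq_in_map => j.
by rewrite mem_iota nth_cat => /= ->.
Qed.

Lemma subcomp_catS a1 a2 x b i :
  all (fun x => 0 < x) a1 -> sumn a1 = x ->
  subcomp (a1 ++ a2) (x :: b) i.+1 = subcomp a2 b i.
Proof.
move=> p1 s1; rewrite /subcomp size_cat iotaD filter_cat map_cat.
rewrite (_ : filter _ _ = [::]).
  rewrite add0n -[X in iota X]addn0 iotaDl filter_map -map_comp /=.
  rewrite (eq_filter (a2 := fun j => all (fun k => k \in block b i) (block a2 j))).
    by apply: eq_map => j /=; rewrite nth_cat ltnNge leq_addr /= addKn.
  move=> j /=; rewrite block_cat_r s1 all_map block_consS; apply: eq_all => k /=.
  by rewrite (mem_map (@addnI x)).
apply/eqP; rewrite -size_eq0 size_filter -leqn0 leqNgt -has_count.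
apply/hasP => -[j]; rewrite mem_iota /= => hj; rewrite block_cat_l //.
move/allP/(_ _ (block_last p1 hj)); rewrite block_consS => /mapP[k].
rewrite mem_block => hk; have := block_le hj (block_last p1 hj); lia.
Qed.

Lemma pi2_cat a1 a2 x b :
  all (fun x => 0 < x) a1 -> all (fun x => 0 < x) a2 -> sumn a1 = x ->
  pi2 (a1 ++ a2) (x :: b) = piC a1 * pi2 a2 b.
Proof.
move=> p1 p2 s1; rewrite /pi2 big_ord_recl subcomp_cat0 //; congr (_ * _).
by apply: eq_bigr => i _; rewrite /= subcomp_catS.
Qed.

(** Induction on [b]. Its first part [x] is a partial sum of [a], which splits [a] in two: on the
    first piece the distance of [t] is [t] itself, giving [piC]; on the second everything is shifted
    by [x]. *)
Lemma pi2E a b :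
  all (fun x => 0 < x) a -> all (fun x => 0 < x) b -> sumn a = sumn b ->
  {subset psums b <= psums a} -> pi2 a b = \prod_(t <- psums a) dist b t.
Proof.
elim: b a => [|x b IH] a pa pb hs hsub.
  have -> : a = [::] by case: a pa hs {hsub} => //= *; lia.
  by rewrite /pi2 big_ord0 big_nil.
(* Here [k] is the number of parts of [a] that make up the first block of [b]. *)
have /mapP[k _ hx] : x \in psums a by apply: hsub; rewrite mem_psums_cons eqxx.
move: pa hs hsub; rewrite -(cat_take_drop k a) all_cat sumn_cat -hx /=.
move: (take k a) (drop k a) hx => a1 a2 hx /andP[p1 p2] /addnI hs hsub.
case/andP: pb => x0 pb; rewrite pi2_cat // piCE IH //.
  rewrite psums_cat big_cat big_map -hx /=; congr (_ * _).
    by apply: eq_big_seq => t /leq_psums; rewrite hx => ->.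
  apply: eq_big_seq => t /(psums_gt0 p2) t0.
  by rewrite addKn; case: leqP => //; lia.
move=> t ht; have t0 := psums_gt0 pb ht.
have : x + t \in psums (a1 ++ a2).
  by apply: hsub; rewrite psums_cons inE map_f ?orbT.
rewrite psums_cat -hx mem_cat (mem_map (@addnI x)) => /orP[/leq_psums|//]; lia.
Qed.

Lemma comp_le_psums a b : a != [::] -> b != [::] -> sumn a = sumn b ->
  comp_le a b -> {subset psums b <= psums a}.
Proof.
move=> a0 b0 hs /allP h t; rewrite !psumsE // !mem_rcons !inE hs.
by case/orP => [->//|/h ->]; rewrite orbT.
Qed.

(** * Summands as products of local weights *)

Lemma uniq_Sset a : all (fun x => 0 < x) a -> uniq (Sset a).
Proof.
case/lastP: a => // a x; rewrite all_rcons Sset_rcons => /andP[_].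
exact: uniq_psums.
Qed.

Lemma Sset_bound a k : all (fun x => 0 < x) a -> k \in Sset a -> 0 < k < sumn a.
Proof. by move=> pa; rewrite mem_Sset // => /andP[/(psums_gt0 pa) -> ->]. Qed.

Lemma prod_sign (S T : seq nat) m : uniq S -> all (fun i => 0 < i < m.+1) S ->
  (\prod_(1 <= k < m.+1) (if (k \in S) && (k \notin T) then -1 else 1)
    = (-1) ^+ count (fun i => i \notin T) S :> rat)%R.
Proof.
move=> uS hS; rewrite -big_mkcond /= big_const_seq iter_mulr_1.
congr (_ ^+ _)%R; rewrite -[RHS]size_filter -size_filter; apply: perm_size.
apply: uniq_perm; rewrite ?filter_uniq ?iota_uniq // => k.
rewrite !mem_filter mem_index_iota; case: (boolP (k \in S)) => [/(allP hS)->|_].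
  by rewrite andbT.
by rewrite andbF.
Qed.

Lemma prod_inv (T : seq nat) (d : nat -> nat) m :
  uniq T -> all (fun i => 0 < i < m.+1) T ->
  (\prod_(1 <= k < m.+1) (if k \in T then (d k)%:R^-1 else 1)
    = (\prod_(t <- T) d t)%:R^-1 :> rat)%R.
Proof.
move=> uT hT; rewrite -big_mkcond /= natr_prod -prodfV -big_filter.
apply: perm_big; apply: uniq_perm; rewrite ?filter_uniq ?iota_uniq // => k.
rewrite mem_filter mem_index_iota andb_idr // => /(allP hT); lia.
Qed.

(** If both conditions hold, cuts give the inverse distances and uncut elements of S give the signs.
    If one fails, some local weight vanishes. *)
Lemma term_weight m (S a b : seq nat) :
  uniq S -> all (fun i => 0 < i < m.+1) S ->
  a \in compositions m.+1 -> b \in compositions m.+1 ->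
  ((if unimodal a S && comp_le a b
    then (-1) ^+ count (fun i => i \notin Sset a) S / (pi2 a b)%:R else 0)
  = weight (mem S) (mem (Sset b)) (dist b) m (Sset a) / (dist b m.+1)%:R)%R.
Proof.
rewrite !mem_compositions => uS hS /andP[pa /eqP sa] /andP[pb /eqP sb].
have a0 : a != [::] by case: (a) sa.
have b0 : b != [::] by case: (b) sb.
have hSa : all (fun i => 0 < i < sumn a) S by rewrite sa.
case: ifP => [/andP[hu hle]|/negbT].
  have sub := comp_le_psums a0 b0 (etrans sa (esym sb)) hle.
  (* The last partial sum is the total [m.+1]; its distance becomes the separate denominator. *)
  rewrite pi2E ?sa ?sb // psumsE // -cats1 big_cat big_seq1 sa natrM invfM mulrA.
  congr (_ * _)%R; rewrite /weight -(prod_sign (Sset a) uS hS).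
  rewrite -(@prod_inv (Sset a) (dist b) m) ?uniq_Sset //; last first.
    by apply/allP => k /(Sset_bound pa); rewrite sa.
  rewrite -big_split /= !big_nat; apply: eq_bigr => k hk; rewrite /local_weight /=.
  case: (boolP (k \in Sset a)) => kT /=; first by rewrite andbF mul1r.
  rewrite andbT mulr1; have /negbTE -> : k \notin Sset b by apply: contra kT => /(allP hle).
  case: ifP => // kS; case: ifP => // /negbT; rewrite negb_or => /andP[h1 h2].
  by case/negP: h2; apply: (elimT (unimodalP hSa) hu k).
rewrite negb_and => hne.
suff [k hk h0] : exists2 k, 0 < k < m.+1 &
    local_weight (mem S) (mem (Sset b)) (dist b) k (k.-1 \in 0 :: Sset a) (k \in Sset a) = 0%R.
  rewrite /weight (_ : \prod_(_ <= _ < _) _ = 0)%R ?mul0r //; apply/eqP.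
  rewrite prodf_seq_eq0; apply/hasP; exists k; first by rewrite mem_index_iota.
  by rewrite /= h0.
(* The vanishing factor sits at an element of S violating the local form of unimodality, or at a
   break of [b] missing from [Sset a]. *)
case/orP: hne => [hu|/allPn[k kB kT]].
  have /hasP[k kS /and3P[kT k1T k1S]] : has (fun k => [&& k \notin Sset a,
      k.-1 \notin 0 :: Sset a & k.-1 \notin S]) S.
    apply: contraR hu => /hasPn h; apply/(unimodalP hSa) => k kS kT k1T.
    by have := h k kS; rewrite kT k1T /= negbK.
  exists k; first exact: (allP hS).
  by rewrite /local_weight (negbTE kT) (negbTE k1T) /= kS (negbTE k1S); case: ifP.
exists k; first by rewrite -sb; apply: Sset_bound.
by rewrite /local_weight (negbTE kT) /= kB.
Qed.

Lemma sum_refinements m (S b : seq nat) :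
  uniq S -> all (fun i => 0 < i < m.+1) S -> b \in compositions m.+1 ->
  (\sum_(a <- compositions m.+1 | unimodal a S && comp_le a b)
    (-1) ^+ count (fun i => i \notin Sset a) S / (pi2 a b)%:R
  = (all (mem (Sset b)) S)%:R :> rat)%R.
Proof.
move=> uS hS hb; rewrite big_mkcond big_seq.
under eq_bigr => a ha do rewrite (term_weight uS hS ha hb).
rewrite -big_seq -(big_map Sset xpredT
  (fun T => weight (mem S) (mem (Sset b)) (dist b) m T / (dist b m.+1)%:R)%R).
rewrite (perm_big _ (perm_Sset_compositions m)) /=.
move: hb; rewrite mem_compositions => /andP[pb /eqP sb].
rewrite sum_weight ?dist0 //=.
- congr (nat_of_bool _)%:R%R; apply/allP/allP => /= h k.
    move=> kS; have /h : k \in iota 1 m by rewrite mem_iota; have := allP hS k kS; lia.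
    by rewrite kS.
  by rewrite mem_iota => _; apply/implyP => /h.
- by apply/negP => /(allP hS).
- by apply/negP => /(Sset_bound pb).
- by move=> k hk; rewrite distS ?sb // mem_Sset // sb hk andbT.
Qed.

(** * Coefficients of the monomial functions *)

Lemma lift_ord_seq m (s : seq nat) :
  all (fun k => k < m) s -> exists u : seq 'I_m, map val u = s.
Proof.
elim: s => [|k s IH]; first by exists [::].
by case/andP=> hk /IH[u <-]; exists (Ordinal hk :: u).
Qed.

(** Both coefficients count tuples for which a single candidate [s] exists, so each count is 0 or
    1. *)
Lemma card_tuple_ord n m (Q : pred (n.-tuple 'I_m)) (P : bool) (s : seq nat) :
  all (fun k => k < m) s -> (P -> size s = n) ->
  (forall t, Q t = P && (map val t == s)) -> #|Q| = P.
Proof.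
move=> hall; case: P => [/(_ isT) hs|_] hQ; last first.
  by apply: eq_card0 => t; apply: hQ.
have [u hu] := lift_ord_seq hall.
have su : size u == n by rewrite -hs -hu size_map.
apply: etrans (card1 (Tuple su)); apply: eq_card => t.
by rewrite [LHS]hQ -hu (inj_eq (inj_map val_inj)) inE -val_eqE.
Qed.

Lemma sum_tuple_val m (b : seq nat) (t : (size b).-tuple 'I_m) k :
  \sum_(u < size b) ((val (tnth t u) == k) * nth 0 b u)
  = \sum_(p <- zip (map val t) b) (p.1 == k) * p.2.
Proof.
rewrite (big_nth (0, 0)) size_zip size_map size_tuple minnn big_mkord.
apply: eq_bigr => u _; rewrite nth_zip ?size_map ?size_tuple //=.
by rewrite (nth_map (tnth t u)) ?size_tuple // -tnth_nth.
Qed.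

(** As all parts are positive, the indices used are exactly the positions of nonzero exponents;
    being strictly increasing, they form the list [s]. *)
Lemma Mcoef_eq b e : all (fun x => 0 < x) b ->
  Mcoef b e = (b == [seq x <- e | 0 < x]).
Proof.
move=> pb; set s := [seq k <- iota 0 (size e) | 0 < nth 0 e k].
have es : map (nth 0 e) s = [seq x <- e | 0 < x].
  by rewrite -[in RHS](mkseq_nth 0 e) filter_map.
have hsort : sorted ltn s by apply/sorted_filter/iota_ltn_sorted/ltn_trans.
apply: (card_tuple_ord (s := s)).
- by apply/allP => k; rewrite mem_filter mem_iota => /andP[_].
- by move=> /eqP ->; rewrite -es size_map.
move=> t; apply/andP/andP => [[ht /allP he]|[/eqP eb /eqP et]].
  have ut : uniq (map val t) by apply: sorted_uniq ht; [exact: ltn_trans|exact: ltnn].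
  (* The indices are distinct, so only the summand [u] contributes to the exponent of its
     variable. *)
  have heu u : nth 0 e (tnth t u) = nth 0 b u.
    have /he/eqP -> : val (tnth t u) \in iota 0 (size e) by rewrite mem_iota /=.
    rewrite (bigD1 u) //= eqxx mul1n big1 ?addn0 // => v vu.
    rewrite (map_inj_uniq val_inj) in ut; have/tuple_uniqP tinj := ut.
    by rewrite (inj_eq val_inj) (inj_eq tinj) (negbTE vu).
  have eb : b = map (nth 0 e) (map val t).
    apply: (@eq_from_nth _ 0) => [|i hi]; first by rewrite !size_map size_tuple.
    have x0 := tnth t (Ordinal hi); rewrite -map_comp (nth_map x0) ?size_tuple //.
    by rewrite -(heu (Ordinal hi)) (tnth_nth x0).
  have est : map val t = s.
    apply: (irr_sorted_eq ltn_trans ltnn ht hsort) => k.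
    rewrite mem_filter mem_iota /=.
    apply/mapP/andP => [[u /tnthP[v ->] ->]|[h0 hk]].
      by rewrite heu; split => //; apply: (all_nthP 0 pb).
    have /he/eqP hek : k \in iota 0 (size e) by rewrite mem_iota.
    case: (pickP (fun u => val (tnth t u) == k)) => [u /eqP <-|hn].
      by exists (tnth t u); rewrite ?mem_tnth.
    by move: h0; rewrite hek big1 // => u _; rewrite hn.
  by rewrite est eqxx eb est es eqxx.
split; first by rewrite et.
apply/allP => k; rewrite mem_iota /= => hk.
rewrite sum_tuple_val et eb -es.
have -> : zip s (map (nth 0 e) s) = [seq (j, nth 0 e j) | j <- s].
  by elim: (s) => //= j r ->.
rewrite big_map /=.
have us : uniq s by rewrite filter_uniq ?iota_uniq.
case: (boolP (k \in s)) => ks.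
  rewrite (bigD1_seq k) //= eqxx mul1n big1 ?addn0 // => j /negbTE ->.
  by rewrite mul0n.
rewrite big1_seq => [|j /andP[_ js]]; last first.
  by case: eqP => // jk; rewrite -jk js in ks.
by move: ks; rewrite mem_filter mem_iota /= hk andbT; case: (nth 0 e k).
Qed.

(** * Coefficients of the fundamental functions *)

(** The weakly increasing word of content [e]; the offset [c] is the first letter available and
    serves the recursion. *)
Fixpoint word (c : nat) (e : seq nat) : seq nat :=
  if e is x :: e' then nseq x c ++ word c.+1 e' else [::].

Lemma size_word c e : size (word c e) = sumn e.
Proof. by elim: e c => //= x e IH c; rewrite size_cat size_nseq IH. Qed.

Lemma word_bound c e k : k \in word c e -> c <= k < c + size e.
Proof.
elim: e c => //= x e IH c; rewrite mem_cat => /orP[|/IH]; last by lia.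
by rewrite mem_nseq => /andP[_ /eqP ->]; lia.
Qed.

Lemma count_word c e k : c <= k -> count_mem k (word c e) = nth 0 e (k - c).
Proof.
elim: e c => [|x e IH] c hk; first by rewrite nth_nil.
rewrite /= count_cat count_nseq /=; case: (ltngtP c k) hk => // [hk _|-> _].
  by rewrite IH // mul0n add0n -(subnSK hk).
rewrite subnn mul1n /= (_ : count_mem _ _ = 0) ?addn0 //.
by apply/eqP; rewrite -leqn0 leqNgt -has_count has_pred1; apply/negP => /word_bound; lia.
Qed.

Lemma sorted_word c e : sorted leq (word c e).
Proof.
elim: e c => //= x e IH c.
rewrite sorted_pairwise ?pairwise_cat; last exact: leq_trans.
rewrite -!sorted_pairwise ?IH ?andbT; try exact: leq_trans.
apply/andP; split; last by case: x => //= x; elim: x => //= x; rewrite leqnn.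
apply/allrelP => u v; rewrite mem_nseq => /andP[_ /eqP ->] /word_bound; lia.
Qed.

(** Ascents occur where a run of equal letters ends, and the run lengths are the nonzero entries of
    [e]. Positions in [nth] start at 0, so letter number [i] is at [i.-1]. *)
Lemma ascent_word c e i : 0 < i < sumn e ->
  (nth 0 (word c e) i.-1 < nth 0 (word c e) i) = (i \in psums [seq x <- e | 0 < x]).
Proof.
elim: e c i => [|x e IH] c i; first by rewrite /=; lia.
have [->|x0] := posnP x; first exact: IH.
rewrite [sumn _]/= [word _ _]/= [filter _ _]/= x0 !nth_cat size_nseq => hi.
rewrite psums_cons inE.
have [hix|hxi|ix] := ltngtP i x.
- rewrite !nth_nseq hix; have -> : i.-1 < x by lia.
  rewrite ltnn; apply/esym/mapP => -[j _]; lia.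
- have -> : (i.-1 < x) = false by lia.
  have -> : i.-1 - x = (i - x).-1 by lia.
  rewrite IH; last by lia.
  apply/idP/mapP => [h|[j hj ->]]; last by rewrite addKn.
  by exists (i - x) => //; rewrite subnKC // ltnW.
rewrite ix subnn; have -> : x.-1 < x by lia.
rewrite nth_nseq (_ : x.-1 < x); last by lia.
have /word_bound : nth 0 (word c.+1 e) 0 \in word c.+1 e; last by lia.
by rewrite mem_nth // size_word; lia.
Qed.

Lemma sumn_filter_gt0 (e : seq nat) : sumn [seq x <- e | 0 < x] = sumn e.
Proof. by elim: e => //= x e; case: posnP => [->|_] /= ->. Qed.

(** A weakly increasing word is determined by its content, and the strict inequalities ask that its
    ascents include S. *)
Lemma Fcoef_eq n (S e : seq nat) : all (fun i => 0 < i < n) S ->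
  Fcoef n S e = (sumn e == n) && all (mem (Sset [seq x <- e | 0 < x])) S.
Proof.
move=> hS; set b := [seq x <- e | 0 < x].
have pb : all (fun x => 0 < x) b by apply: filter_all.
have sb : sumn b = sumn e := sumn_filter_gt0 e.
apply: (card_tuple_ord (s := word 0 e)).
- by apply/allP => k /word_bound.
- by rewrite size_word => /andP[/eqP].
move=> t; set w := map val t; have sw : size w = n by rewrite size_map size_tuple.
have hSb : sumn e = n -> all (mem (Sset b)) S
    = all (fun i => nth 0 (word 0 e) i.-1 < nth 0 (word 0 e) i) S.
  move=> se; apply: eq_in_all => i /(allP hS) hi /=.
  by rewrite ascent_word ?se // mem_Sset // sb se; case/andP: hi => _ ->; rewrite andbT.
apply/andP/andP => [[/allP hasc /allP hcnt]|[/andP[/eqP se hall] /eqP hw]].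
  have hsort : sorted leq w.
    apply/(sortedP 0) => i; rewrite sw => hi.
    have /hasc : i \in iota 0 n.-1 by rewrite mem_iota; lia.
    by case: ifP => // _ /ltnW.
  have ew : w = word 0 e.
    apply: (sorted_eq leq_trans anti_leq hsort (sorted_word 0 e)).
    apply/allP => k _ /=; rewrite count_word // subn0.
    have [hk|hk] := ltnP k (size e).
      by have /hcnt/eqP -> : k \in iota 0 (size e) by rewrite mem_iota.
    rewrite nth_default //; apply/eqP/count_memPn/mapP => -[j _ hj].
    by have := ltn_ord j; rewrite /= in hj; lia.
  have se : sumn e = n by rewrite -sw ew size_word.
  rewrite ew eqxx hSb // se eqxx; split => //; apply/allP => i iS.
  have hi := allP hS i iS.
  have /hasc : i.-1 \in iota 0 n.-1 by rewrite mem_iota; lia.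
  by rewrite -ew prednK ?iS //; case/andP: hi.
rewrite hSb // in hall; rewrite -/w hw; split; apply/allP => i; rewrite mem_iota => /= hi.
  case: ifP => [/(allP hall)//|_].
  by have /(sortedP 0) := sorted_word 0 e; apply; rewrite size_word se; lia.
by rewrite count_word // subn0.
Qed.

(** * Coefficients of the power sums and conclusion *)

Lemma zee_neq0 a : ((zee a)%:R != 0 :> rat)%R.
Proof.
rewrite pnatr_eq0 -lt0n /zee big_nat prodn_cond_gt0 // => i /andP[i0 _].
by rewrite muln_gt0 expn_gt0 i0 fact_gt0.
Qed.

(** Among the monomial functions in the expansion only the one indexed by the nonzero entries of [e]
    contains this monomial. *)
Lemma Psicoef_eq n a e : a \in compositions n ->
  let b := [seq x <- e | 0 < x] in
  (Psicoef a e / (zee a)%:R =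
     if (sumn e == n) && comp_le a b then (pi2 a b)%:R^-1 else 0)%R.
Proof.
rewrite mem_compositions => /andP[pa /eqP sa] b.
rewrite /Psicoef mulrAC divff ?zee_neq0 // mul1r sa.
have hb : (b \in compositions n) = (sumn e == n).
  by rewrite mem_compositions /is_comp filter_all sumn_filter_gt0.
rewrite -hb big_mkcond big_seq.
rewrite (eq_bigr (fun c => if c == b then
   (if comp_le a b then (pi2 a b)%:R^-1 else 0) else 0)%R).
  rewrite -big_seq -big_mkcond; have [bn|bn] := boolP (b \in _).
    by rewrite -big_filter filter_pred1_uniq ?uniq_compositions // big_seq1.
  by rewrite big1_seq // => c /andP[/eqP -> hc]; rewrite hc in bn.
move=> c; rewrite mem_compositions => /andP[pc _].
rewrite Mcoef_eq //; case: eqP => [->|_]; first by rewrite mulr1.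
by rewrite mulr0; case: ifP.
Qed.

Theorem theorem3p1 (n : nat) (S : seq nat) :
  uniq S -> all (fun i => 0 < i < n) S ->
  forall e : seq nat,
    ((Fcoef n S e)%:R : rat) =
    (\sum_(a <- compositions n | unimodal a S)
        Psicoef a e / (zee a)%:R * (-1) ^+ count (fun i => i \notin Sset a) S)%R.
Proof.
move=> uS hS e; rewrite Fcoef_eq // big_seq_cond.
set b := [seq x <- e | 0 < x].
under eq_bigr => a /andP[ha _] do rewrite (Psicoef_eq e ha).
rewrite -big_seq_cond -/b; case: eqP => [se|_] /=; last first.
  by rewrite big1 // => a _; rewrite mul0r.
have hb : b \in compositions n.
  by rewrite mem_compositions /is_comp filter_all sumn_filter_gt0 se eqxx.
(* The subset encoding needs n = m+1. For n = 0 the only composition is empty and both sides equal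
   1. *)
case: n hS se hb => [|m] hS se hb.
  have -> : S = [::] by case: (S) hS => //= i s; rewrite ltn0 andbF.
  have -> : b = [::].
    by move: hb; rewrite mem_compositions; case: (b) => //= x s; rewrite /is_comp /=; lia.
  by rewrite [compositions 0]/= big_mkcond big_seq1 /pi2 big_ord0 /= invr1 mulr1.
rewrite -(sum_refinements uS hS hb) big_mkcondr /=; apply: eq_bigr => a _.
by case: ifP; rewrite ?mul0r // mulrC.
Qed.
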